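(* Let $T,S\in\mathcal{B}_A(\mathcal{H})$. Then $$\omega_A(T+S)\le\sqrt{\tfrac12\Big(\|TT^{\sharp_A}+SS^{\sharp_A}\|_A+\|TT^{\sharp_A}-SS^{\sharp_A}\|_A\Big)+\omega_A(ST^{\sharp_A})+2\,\omega_A(T)\,\omega_A(S)}.$$
   Context: $\mathcal{H}$ is a complex Hilbert space with inner product $\langle\cdot,\cdot\rangle$, and $A$ is a fixed nonzero positive bounded operator on $\mathcal{H}$. Set $\langle x,y\rangle_A=\langle Ax,y\rangle$ and $\|x\|_A=\|A^{1/2}x\|$. $\mathcal{B}_A(\mathcal{H})$ is the set of bounded operators $T$ for which there exists a bounded $S$ with $\langle Tx,y\rangle_A=\langle x,Sy\rangle_A$ for all $x,y$ (equivalently $\mathcal{R}(T^*A)\subseteq\mathcal{R}(A)$). For $T\in\mathcal{B}_A(\mathcal{H})$, $T^{\sharp_A}=A^\dagger T^*A$ ($A^\dagger$ the Moore–Penrose inverse) is the reduced solution of $AX=T^*A$. For an operator $T$ with $\|Tx\|_A\le\lambda\|x\|_A$ for some $\lambda>0$ and all $x$, $\|T\|_A=\sup\{\|Tx\|_A: \|x\|_A=1\}$, and $\omega_A(T)=\sup\{|\langle Tx,x\rangle_A|:\|x\|_A=1\}$. *)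

(* Defs.v *)
From HB Require Import structures.
From mathcomp Require Import all_boot all_order all_algebra.
From mathcomp Require Import boolp classical_sets reals.
From mathcomp.real_closed Require Import complex.
Set Implicit Arguments. Unset Strict Implicit. Unset Printing Implicit Defensive.
Import Order.TTheory GRing.Theory Num.Theory.
Local Open Scope ring_scope.
Local Open Scope classical_set_scope.

Section Hilbert.
Variables (R : realType) (H : lmodType R[i]) (ip : H -> H -> R[i]).

Definition ipnorm (x : H) : R := Num.sqrt (complex.Re (ip x x)).

Definition is_hilbert : Prop :=
  [/\ (forall (a : R[i]) x y z, ip (a *: x + y) z = a * ip x z + ip y z),
      (forall x y, ip y x = conjc (ip x y)),
      (forall x, 0 <= ip x x),
      (forall x, ip x x = 0 -> x = 0) &
      (forall u : nat -> H,
          (forall e : R, 0 < e -> exists N, forall m n, (N <= m)%N -> (N <= n)%N ->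
              ipnorm (u m - u n) < e) ->
          exists l, forall e : R, 0 < e -> exists N, forall n, (N <= n)%N ->
              ipnorm (u n - l) < e)].

Definition is_bounded_op (T : H -> H) : Prop :=
  (forall (a : R[i]) x y, T (a *: x + y) = a *: T x + T y) /\
  exists c : R, forall x, ipnorm (T x) <= c * ipnorm x.

Definition is_positive_op (A : H -> H) : Prop :=
  is_bounded_op A /\ forall x, 0 <= ip (A x) x.

Definition adjoint (T : H -> H) (y : H) : H :=
  xget 0 [set z | forall x, ip (T x) y = ip x z].

(* Moore--Penrose inverse of A, on R(A): A^dagger y is the unique x in N(A)^perp
   with A x = y *)
Definition mp_inv (A : H -> H) (y : H) : H :=
  xget 0 [set x | A x = y /\ forall z, A z = 0 -> ip x z = 0].

Variable A : H -> H.

Definition ipA (x y : H) : R[i] := ip (A x) y.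
Definition normA (x : H) : R := Num.sqrt (complex.Re (ip (A x) x)).

Definition in_BA (T : H -> H) : Prop :=
  is_bounded_op T /\
  exists S, is_bounded_op S /\ forall x y, ipA (T x) y = ipA x (S y).

Definition sharpA (T : H -> H) : H -> H := fun x => mp_inv A (adjoint T (A x)).

Definition opnormA (T : H -> H) : R :=
  sup [set normA (T x) | x in [set x | normA x = 1]].

Definition omegaA (T : H -> H) : R :=
  sup [set ComplexField.Normc.normc (ipA (T x) x) | x in [set x | normA x = 1]].

End Hilbert.

Definition op_add {R : realType} {H : lmodType R[i]} (T S : H -> H) : H -> H :=
  fun x => T x + S x.
Definition op_sub {R : realType} {H : lmodType R[i]} (T S : H -> H) : H -> H :=
  fun x => T x - S x.
Definition op_comp {R : realType} {H : lmodType R[i]} (T S : H -> H) : H -> H :=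
  fun x => T (S x).

(* Main.v *)
(* For [x] with [||x||_A = 1], [|<(T+S)x,x>_A|^2] is at most
   [|<x,T'x>_A|^2 + |<x,S'x>_A|^2 + 2 w_A(T) w_A(S)], where [T'], [S'] are the sharp adjoints.
   The Boas-Bellman inequality bounds the first two terms by
   [max(||T'x||_A^2, ||S'x||_A^2) + |<T'x,S'x>_A|]; the last summand is [|<ST'x,x>_A|], and
   the maximum is half of [<(TT'+SS')x,x>_A + |<(TT'-SS')x,x>_A|].
   The suprema are finite because operators in [B_A] are [A]-bounded, and the
   Moore-Penrose inverse takes meaningful values by the projection theorem. *)
Require Import Defs.
From HB Require Import structures.
From mathcomp Require Import all_boot all_order all_algebra.
From mathcomp Require Import boolp classical_sets reals.
From mathcomp Require Import ring lra.
From mathcomp.real_closed Require Import complex.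
Set Implicit Arguments. Unset Strict Implicit. Unset Printing Implicit Defensive.
Import Order.TTheory GRing.Theory Num.Theory.
Local Open Scope ring_scope.

Local Notation normc := ComplexField.Normc.normc.
Local Notation Re := complex.Re.
Local Notation Im := complex.Im.

(** * Modulus and real part of complex numbers *)

Lemma sqr_normcE (R : rcfType) (z : R[i]) : normc z ^+ 2 = Re z ^+ 2 + Im z ^+ 2.
Proof. by case: z => a b; rewrite sqr_sqrtr ?addr_ge0 ?sqr_ge0. Qed.

Lemma normc_nonneg (R : rcfType) (z : R[i]) : 0 <= normc z.
Proof. by case: z => a b; apply: sqrtr_ge0. Qed.

Lemma Re_le_normc (R : rcfType) (z : R[i]) : Re z <= normc z.
Proof.
rewrite (le_trans (ler_norm _)) // -sqrtr_sqr; case: z => a b /=.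
by rewrite ler_wsqrtr // lerDl sqr_ge0.
Qed.

Lemma normc_conj (R : rcfType) (z : R[i]) : normc (conjc z) = normc z.
Proof. by case: z => a b; rewrite /= sqrrN. Qed.

(* [le_normcD] and [normcN] restated on [R[i]] rather than on its copy [Rcomplex R]. *)
Lemma normc_leD (R : rcfType) (x y : R[i]) : normc (x + y) <= normc x + normc y.
Proof. exact: le_normcD. Qed.

Lemma normc_leB (R : rcfType) (x y : R[i]) : normc (x - y) <= normc x + normc y.
Proof. by rewrite (le_trans (normc_leD _ _)) // lerD2l [leLHS]normcN. Qed.

(** * Growth of log-convex real sequences *)

Lemma bernoulli_ineq (R : realDomainType) (d : R) (n : nat) :
  0 <= d -> 1 + n%:R * d <= (1 + d) ^+ n.
Proof.
move=> d0; elim: n => [|n IH]; first by rewrite mul0r addr0 expr0.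
rewrite exprS; have h1 : 0 <= 1 + d by rewrite addr_ge0.
apply: le_trans (ler_wpM2l h1 IH).
have : 0 <= n%:R * d * d by rewrite !mulr_ge0.
by rewrite -natr1; lra.
Qed.

Lemma geometric_dominated (R : realType) (r K a C : R) :
  0 < K -> 0 < a -> (forall n, r ^+ n * a <= C * K ^+ n) -> r <= K.
Proof.
move=> K0 a0 h; rewrite leNgt; apply/negP => Kr.
pose d := r / K - 1.
have d0 : 0 < d by rewrite subr_gt0 ltr_pdivlMr // mul1r.
have rE : r = (1 + d) * K by rewrite /d addrC subrK divfK // gt_eqF.
have C0 : 0 <= C / a by rewrite divr_ge0 ?(ltW a0) // ltW // (lt_le_trans a0) //;
  have := h 0%N; rewrite !expr0 mul1r mulr1.
(* An [n] beyond [C / (a * d)] makes [(1 + n%:R * d) * a] exceed [C], against Bernoulli. *)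
have := archi_boundP (divr_ge0 C0 (ltW d0)).
set n := Num.Def.archi_bound _; rewrite ltr_pdivrMr // ltr_pdivrMr // => hn.
have := h n; rewrite rE exprMn mulrAC ler_pM2r ?exprn_gt0 // => h2.
have := bernoulli_ineq n (ltW d0) => h3.
have : (1 + n%:R * d) * a <= C by apply: le_trans h2; rewrite ler_pM2r.
by rewrite mulrDl mul1r; lra.
Qed.

(** Successive ratios of a log-convex sequence do not decrease, so [a n] is at least [r ^+ n * a 0]
    with [r = a 1 / a 0], and the geometric upper bound forces [r <= K]. The constant [C] leaves no
    trace in the conclusion. *)
Lemma log_convex_ratio (R : realType) (a : nat -> R) (C K : R) :
  0 < K -> (forall n, 0 <= a n) ->
  (forall n, a n.+1 ^+ 2 <= a n * a n.+2) ->
  (forall n, a n <= C * K ^+ n) -> a 1%N <= K * a 0%N.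
Proof.
move=> K0 a0 lc bd.
have [h0|] := eqVneq (a 0%N) 0.
  have := lc 0%N; rewrite h0 mul0r => h.
  have : a 1%N == 0 by rewrite -sqrf_eq0 eq_le h sqr_ge0.
  by move/eqP ->; rewrite mulr0.
move=> n0; have p0 : 0 < a 0%N by rewrite lt_def n0 a0.
pose r := a 1%N / a 0%N.
have r0 : 0 <= r by rewrite divr_ge0.
have step n : r * a n <= a n.+1.
  elim: n => [|n IH]; first by rewrite divfK.
  have [->|n1] := eqVneq (a n.+1) 0; first by rewrite mulr0.
  have p1 : 0 < a n.+1 by rewrite lt_def n1 a0.
  (* After multiplication by [a n.+1]: [r * a n.+1 ^+ 2 <= r * a n * a n.+2 <= a n.+1 * a n.+2]. *)
  rewrite -(ler_pM2r p1) -mulrA -expr2 (le_trans (ler_wpM2l r0 (lc n))) // mulrA.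
  by rewrite [leRHS]mulrC ler_wpM2r.
rewrite -ler_pdivrMr //; apply: (@geometric_dominated _ _ _ (a 0%N) C) => // n.
apply: le_trans (bd n); elim: n => [|n IH]; first by rewrite expr0 mul1r.
by rewrite exprS -mulrA (le_trans _ (step n)) // ler_wpM2l.
Qed.

(** * Semi-inner products: Cauchy-Schwarz and Boas-Bellman *)

(** Definiteness is left out so that the same lemmas serve [ip] and the form of [A], whose kernel
    may be nonzero. In the order of [R[i]], [0 <= B x x] also says that [B x x] is real. *)
Definition semi_inner (R : realType) (H : lmodType R[i]) (B : H -> H -> R[i]) : Prop :=
  [/\ (forall (a : R[i]) x y z, B (a *: x + y) z = a * B x z + B y z),
      (forall x y, B y x = conjc (B x y)) &
      (forall x, 0 <= B x x)].

Section SemiInner.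
Variables (R : realType) (H : lmodType R[i]) (B : H -> H -> R[i]).
Hypothesis hB : semi_inner B.
Local Notation N := (ipnorm B).

Lemma formDl x y z : B (x + y) z = B x z + B y z.
Proof. by case: hB => l _ _; rewrite -[x in LHS]scale1r l mul1r. Qed.

Lemma form0l z : B 0 z = 0.
Proof. by apply: (addrI (B 0 z)); rewrite -formDl !addr0. Qed.

Lemma formZl a x z : B (a *: x) z = a * B x z.
Proof. by case: hB => l _ _; rewrite -[_ *: _]addr0 l form0l addr0. Qed.

Lemma formNl x z : B (- x) z = - B x z.
Proof. by rewrite -scaleN1r formZl mulN1r. Qed.

Lemma form_conj x y : B y x = conjc (B x y).
Proof. by case: hB. Qed.

Lemma formDr x y z : B z (x + y) = B z x + B z y.
Proof. by rewrite (form_conj (x + y) z) formDl (form_conj x z) (form_conj y z) rmorphD. Qed.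

Lemma formNr x z : B z (- x) = - B z x.
Proof. by rewrite (form_conj (- x) z) formNl (form_conj x z) rmorphN. Qed.

Lemma formZr a x z : B z (a *: x) = conjc a * B z x.
Proof. by rewrite (form_conj (a *: x) z) formZl (form_conj x z) rmorphM. Qed.

Lemma ipnorm_ge0 x : 0 <= N x.
Proof. exact: sqrtr_ge0. Qed.

Lemma Re_form_ge0 x : 0 <= Re (B x x).
Proof. by case: hB => _ _ /(_ x); rewrite lecE => /andP[]. Qed.

Lemma sqr_ipnorm x : N x ^+ 2 = Re (B x x).
Proof. by rewrite sqr_sqrtr // Re_form_ge0. Qed.

Lemma form_self x : B x x = (N x ^+ 2)%:C%C.
Proof.
rewrite sqr_ipnorm; case: hB => _ _ /(_ x); rewrite lecE => /andP[/eqP /= i0 _].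
by move: i0; case: (B x x) => a b /= ->.
Qed.

Lemma sqr_ipnormD x y :
  N (x + y) ^+ 2 = N x ^+ 2 + 2 * Re (B x y) + N y ^+ 2.
Proof.
rewrite !sqr_ipnorm formDl !formDr (form_conj x y).
by case: (B x x) => ? ?; case: (B x y) => ? ?; case: (B y y) => ? ? /=; ring.
Qed.

Lemma ipnormZ a x : N (a *: x) = normc a * N x.
Proof.
apply/eqP; rewrite -(@eqrXn2 _ 2) ?mulr_ge0 ?ipnorm_ge0 ?normc_nonneg //.
rewrite exprMn sqr_normcE !sqr_ipnorm formZl formZr form_self.
by case: a => a b /=; apply/eqP; ring.
Qed.

Lemma ipnormN x : N (- x) = N x.
Proof. by rewrite /ipnorm formNl formNr opprK. Qed.

(* Minimality up to [e] along the line [x + C y], tested at [a = - B x y / N y ^ 2]. *)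
Lemma almost_minimal_orthogonal (e : R) x y :
  (forall a : R[i], N x ^+ 2 - e <= N (x + a *: y) ^+ 2) ->
  normc (B x y) ^+ 2 <= e * N y ^+ 2.
Proof.
move=> h.
have key (t : R) : 2 * t * normc (B x y) ^+ 2 <= e + t ^+ 2 * normc (B x y) ^+ 2 * N y ^+ 2.
  have := h (- (t%:C%C * B x y)); rewrite sqr_ipnormD ipnormZ exprMn formZr.
  rewrite !sqr_normcE; case: (B x y) => a b /=; move: (N x) (N y) => p q; rewrite !mul0r !subr0 !addr0.
  by lra.
move: key; set c := normc _ ^+ 2; set q := N y ^+ 2 => key.
have c0 : 0 <= c by exact: sqr_ge0.
have q0 : 0 <= q by exact: sqr_ge0.
have [qz|qn] := eqVneq q 0.
  rewrite qz mulr0 leNgt; apply/negP => cp.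
  (* When [q = 0], [key] bounds a linear function of [t] by [e]; this [t] gives it the value
     [e + 1]. *)
  have := key ((e + 1) / (2 * c)); rewrite qz !mulr0 addr0.
  rewrite (_ : 2 * _ * c = e + 1); first by lra.
  by field; rewrite gt_eqF.
have qp : 0 < q by rewrite lt_def qn.
have := key q^-1.
rewrite (_ : _ ^+ 2 * c * q = c / q); last by field.
rewrite (_ : 2 * _ * c = 2 * (c / q)); last by field.
by move=> h2; rewrite -ler_pdivrMr //; lra.
Qed.

(** The case [e = N x ^+ 2] of almost-minimality, where the hypothesis only says that a square is
    nonnegative. *)
Lemma cauchy_schwarz x y : normc (B x y) <= N x * N y.
Proof.
rewrite -ler_sqr ?qualifE /= ?mulr_ge0 ?ipnorm_ge0 ?normc_nonneg //.
rewrite exprMn; apply: almost_minimal_orthogonal => a.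
by rewrite subrr sqr_ge0.
Qed.

Lemma ipnormD x y : N (x + y) <= N x + N y.
Proof.
rewrite -ler_sqr ?qualifE /= ?addr_ge0 ?ipnorm_ge0 //.
rewrite sqr_ipnormD sqrrD -[_ * _ *+ 2]mulr_natl lerD2r lerD2l ler_wpM2l //.
exact: le_trans (Re_le_normc _) (cauchy_schwarz _ _).
Qed.

(** Pairing [x] with [w = B x y *: y + B x z *: z] gives exactly the left side [Q]. Expanding
    [N w ^+ 2] and using [2bc <= b^2 + c^2] on the cross term bounds it by
    [Q * (M + normc (B y z))]; Cauchy-Schwarz for [x] and [w] then leaves a factor [Q] to cancel. *)
Lemma boas_bellman2 x y z (M : R) : N y ^+ 2 <= M -> N z ^+ 2 <= M ->
  normc (B x y) ^+ 2 + normc (B x z) ^+ 2 <= N x ^+ 2 * (M + normc (B y z)).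
Proof.
move=> hy hz; set Q := (X in X <= _).
have M0 : 0 <= M by apply: le_trans hy; exact: sqr_ge0.
pose w := B x y *: y + B x z *: z.
have wx : Re (B x w) = Q.
  rewrite formDr !formZr /Q !sqr_normcE.
  by case: (B x y) => a b; case: (B x z) => c d /=; ring.
have Q2 : Q ^+ 2 <= N x ^+ 2 * N w ^+ 2.
  rewrite -exprMn lerXn2r ?qualifE /= ?mulr_ge0 ?ipnorm_ge0 //.
    by rewrite addr_ge0 ?sqr_ge0.
  by rewrite -wx (le_trans (Re_le_normc _)) ?cauchy_schwarz.
have wQ : N w ^+ 2 <= Q * (M + normc (B y z)).
  rewrite sqr_ipnormD !ipnormZ !exprMn formZl formZr.
  set b := normc (B x y); set c := normc (B x z); set d := normc (B y z).
  have h1 : Re (B x y * (conjc (B x z) * B y z)) <= b * (c * d).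
    by rewrite (le_trans (Re_le_normc _)) // !ComplexField.Normc.normcM normc_conj.
  have h2 : b ^+ 2 * N y ^+ 2 <= b ^+ 2 * M by rewrite ler_wpM2l ?sqr_ge0.
  have h3 : c ^+ 2 * N z ^+ 2 <= c ^+ 2 * M by rewrite ler_wpM2l ?sqr_ge0.
  have h4 : 0 <= (b - c) ^+ 2 * d by rewrite mulr_ge0 ?sqr_ge0 ?normc_nonneg.
  rewrite /Q -/b -/c; move: h1 h2 h3 h4; move: (Re _) (N y ^+ 2) (N z ^+ 2) => u p q.
  by lra.
have [->|Qn] := eqVneq Q 0.
  by rewrite mulr_ge0 ?sqr_ge0 ?addr_ge0 ?normc_nonneg.
have Qp : 0 < Q by rewrite lt_def Qn addr_ge0 ?sqr_ge0.
rewrite -(ler_pM2l Qp) -expr2 (le_trans Q2) // [leRHS]mulrCA ler_wpM2l ?sqr_ge0 //.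
Qed.

End SemiInner.

(** * The projection theorem in a Hilbert space *)

Lemma small_le0 (R : realFieldType) (x c : R) :
  0 <= c -> (forall e, 0 < e -> x <= e * c) -> x <= 0.
Proof.
move=> c0 h; rewrite leNgt; apply/negP => x0.
have c1 : 0 < c + 1 by rewrite ltr_wpDl.
have /h : 0 < x / (c + 1) by rewrite divr_gt0.
by rewrite mulrAC ler_pdivlMr // ler_pM2l // gerDl ler10.
Qed.

Lemma invSn_small (R : realType) (e : R) :
  0 < e -> exists n0, forall n, (n0 <= n)%N -> n.+1%:R^-1 < e.
Proof.
move=> e0; exists (Num.Def.archi_bound e^-1) => n hn.
rewrite invf_plt ?qualifE /= ?ltr0n //.
apply: lt_le_trans (archi_boundP _) _; first by rewrite invr_ge0 ltW.
by rewrite ler_nat ltnW.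
Qed.

Section Hilbert.
Variables (R : realType) (H : lmodType R[i]) (ip : H -> H -> R[i]).
Hypothesis hH : is_hilbert ip.
Local Notation N := (ipnorm ip).

Lemma hilbert_semi_inner : semi_inner ip.
Proof. by case: hH. Qed.
Let hI := hilbert_semi_inner.

Lemma ipnorm_eq0 x : N x <= 0 -> x = 0.
Proof.
move=> h; have n0 : N x = 0 by apply/eqP; rewrite eq_le h ipnorm_ge0.
by case: hH => _ _ _ d _; apply: d; rewrite (form_self hI) n0 expr0n.
Qed.

(** A minimizing sequence [u] for the distance from [y] to [M] has residuals almost orthogonal to
    [M]. This alone makes [u] Cauchy, without the parallelogram law, and orthogonality passes to the
    limit. *)
Lemma orthogonal_projection (M : set H) :
  M 0 -> (forall (a : R[i]) x y, M x -> M y -> M (a *: x + y)) ->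
  (forall l, (forall e : R, 0 < e -> exists2 x, M x & N (x - l) < e) -> M l) ->
  forall y, exists2 l, M l & forall w, M w -> ip (y - l) w = 0.
Proof.
move=> M0 Mlin Mcl y.
pose D := [set N (y - z) ^+ 2 | z in M]%classic.
have Dn0 : (D !=set0)%classic by exists (N (y - 0) ^+ 2); exists 0.
have Dlb : has_lbound D by exists 0 => _ [z _ <-]; exact: sqr_ge0.
have dmin z : M z -> inf D <= N (y - z) ^+ 2.
  by move=> Mz; apply: ge_inf => //; exists z.
(* The excess is a square so that the orthogonality defect, obtained from a squared bound, is
   [n.+1%:R^-1 * N w]. *)
have /choice[u hu] (n : nat) : exists z, M z /\ N (y - z) ^+ 2 < inf D + n.+1%:R^-1 ^+ 2.
  have e0 : 0 < n.+1%:R^-1 ^+ 2 :> R by rewrite exprn_gt0 // invr_gt0 ltr0n.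
  have [_ [z Mz <-] hz] := @inf_adherent _ D _ e0 (conj Dn0 Dlb).
  by exists z.
have orth n w : M w -> normc (ip (y - u n) w) <= n.+1%:R^-1 * N w.
  move=> Mw; have i0 : 0 <= n.+1%:R^-1 :> R by rewrite invr_ge0 ler0n.
  rewrite -ler_sqr ?qualifE /= ?normc_nonneg ?mulr_ge0 ?ipnorm_ge0 // exprMn.
  apply: (almost_minimal_orthogonal hI) => a.
  have [Mu /ltW lu] := hu n.
  rewrite lerBlDr (le_trans lu) // lerD2r.
  have -> : y - u n + a *: w = y - (- a *: w + u n).
    by rewrite opprD scaleNr opprK addrAC addrA.
  exact/dmin/Mlin.
(* The difference [w] lies in [M] and equals [(y - u n) - (y - u m)], two vectors almost orthogonal
   to [w]; hence [N w ^+ 2] is at most a small multiple of [N w]. *)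
have cauchy m n : N (u m - u n) <= m.+1%:R^-1 + n.+1%:R^-1.
  set w := u m - u n.
  have Mw : M w.
    by rewrite /w addrC -scaleN1r; apply: Mlin; [case: (hu n) | case: (hu m)].
  have wE : ip w w = ip (y - u n) w - ip (y - u m) w.
    rewrite -(formNl hI) -(formDl hI); congr (ip _ _).
    by rewrite opprB [RHS]addrC addrA subrK.
  have w2 : N w ^+ 2 <= (m.+1%:R^-1 + n.+1%:R^-1) * N w.
    rewrite (sqr_ipnorm hI) (le_trans (Re_le_normc _)) // wE.
    rewrite (le_trans (normc_leB _ _)) // mulrDl [leRHS]addrC.
    exact: lerD (orth n w Mw) (orth m w Mw).
  have [->|n0] := eqVneq (N w) 0; first by rewrite addr_ge0 // invr_ge0 ler0n.
  have np : 0 < N w by rewrite lt_def n0 ipnorm_ge0.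
  by rewrite -(ler_pM2r np) -expr2.
have [_ _ _ _ /(_ u)[|l hl]] := hH.
  move=> e e0; have e2 : 0 < e / 2 by rewrite divr_gt0.
  have [n0 h0] := invSn_small e2; exists n0 => m n /h0 h1 /h0 h2.
  by rewrite (le_lt_trans (cauchy m n)) // [e]splitr ltrD.
exists l.
  apply: Mcl => e /hl[n0 /(_ n0 (leqnn _)) h]; exists (u n0) => //.
  by case: (hu n0).
move=> w Mw; apply: ComplexField.Normc.eq0_normc.
apply/eqP; rewrite eq_le normc_nonneg andbT.
apply: (@small_le0 _ _ (N w)); first exact: ipnorm_ge0.
move=> e e0; have e2 : 0 < e / 2 by rewrite divr_gt0.
have [n0 h0] := invSn_small e2; have [n1 h1] := hl _ e2.
have {h0} h0 := h0 _ (leq_maxl n0 n1).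
have {h1} := h1 _ (leq_maxr n0 n1); move: h0; set n := maxn _ _ => h0 h1.
have -> : y - l = (y - u n) + (u n - l) by rewrite addrA subrK.
rewrite (formDl hI) (le_trans (normc_leD _ _)) //.
have c1 := orth n w Mw; have c2 := cauchy_schwarz hI (u n - l) w.
have p := ipnorm_ge0 ip w.
have : (n.+1%:R^-1 + N (u n - l)) * N w <= e * N w by rewrite ler_wpM2r // [e]splitr ltW // ltrD.
by apply: le_trans; rewrite mulrDl lerD.
Qed.

(** * Bounded operators and the Moore-Penrose inverse *)

Lemma bounded_opB (A : H -> H) x y : is_bounded_op ip A -> A (x - y) = A x - A y.
Proof. by case=> l _; rewrite addrC -scaleN1r l scaleN1r addrC. Qed.

Lemma bounded_op_gt0 (A : H -> H) : is_bounded_op ip A ->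
  exists2 c : R, 0 < c & forall x, N (A x) <= c * N x.
Proof.
move=> [_ [c hc]]; exists (`|c| + 1); first by rewrite ltr_wpDl.
move=> x; apply: le_trans (hc x) _; rewrite ler_wpM2r ?ipnorm_ge0 //.
by rewrite (le_trans (ler_norm _)) // lerDl.
Qed.

(** The kernel of [A] is closed because [A] is bounded. Subtracting from [u] its projection onto the
    kernel gives a witness for the set defining [mp_inv], so [xget] does not fall back on its
    default [0]. *)
Lemma mp_invK (A : H -> H) u : is_bounded_op ip A -> A (mp_inv ip A (A u)) = A u.
Proof.
move=> bA; have [lA _] := bA; have [c c0 hc] := bounded_op_gt0 bA.
have A0 : A 0 = 0 by have := bounded_opB 0 0 bA; rewrite !subrr.
suff [] : [set x | A x = A u /\ forall z, A z = 0 -> ip x z = 0]%classic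
  (mp_inv ip A (A u)) by [].
apply: xgetPex.
have [||l hl|l Al ol] := @orthogonal_projection [set z | A z = 0]%classic _ _ _ u.
- exact: A0.
- by move=> a x y /= hx hy; rewrite lA hx hy scaler0 addr0.
- apply: ipnorm_eq0; apply: (@small_le0 _ _ c); first exact: ltW.
  move=> e /hl[x /= Ax lx]; rewrite -[A l]opprK (ipnormN hI) -[- A l]add0r -Ax.
  by rewrite -bounded_opB // (le_trans (hc _)) // mulrC ler_wpM2r ?ltW.
- exists (u - l); split; last exact: ol.
  by rewrite bounded_opB // (Al : A l = 0) subr0.
Qed.

(** * The form of [A], [A]-bounded operators and sharp adjoints *)

Variable A : H -> H.
Hypothesis pA : is_positive_op ip A.
Local Notation NA := (normA ip A).
Local Notation B := (ipA ip A).

(* Polarization: over the complex numbers positivity forces symmetry. *)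
Lemma positive_semi_inner : semi_inner B.
Proof.
have [[lA _] pos] := pA; have [l _ _] := hI.
have lB (a : R[i]) x y z : B (a *: x + y) z = a * B x z + B y z by rewrite /ipA lA l.
have rB (a : R[i]) u v z : B z (a *: u + v) = conjc a * B z u + B z v.
  by rewrite /ipA (formDr hI) (formZr hI).
have im0 x : Im (B x x) = 0.
  by have := pos x; rewrite lecE => /andP[/eqP ->].
(* Reality of the form at [x + y] makes the imaginary parts of [B x y] and [B y x] opposite; at
   ['i *: x + y] it makes their real parts equal. *)
split=> // x y; have := im0 ('i%C *: x + y); have := im0 (1 *: x + y).
rewrite !lB !rB.
have := im0 x; have := im0 y.
case: (B x x) => a b; case: (B x y) => c d; case: (B y x) => e f.
case: (B y y) => g h /= -> -> h1 h2; congr (_ +i* _)%C; lra.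
Qed.
Let hB := positive_semi_inner.

Lemma normA_ge0 x : 0 <= NA x.
Proof. exact: sqrtr_ge0. Qed.

Definition A_bounded (T : H -> H) : Prop :=
  exists2 k : R, 0 <= k & forall x, NA (T x) <= k * NA x.

Lemma A_bounded_comp T S : A_bounded T -> A_bounded S -> A_bounded (op_comp T S).
Proof.
move=> [k k0 hk] [l l0 hl]; exists (k * l); first exact: mulr_ge0.
by move=> x; rewrite (le_trans (hk _)) // -mulrA ler_wpM2l.
Qed.

Lemma A_bounded_add T S : A_bounded T -> A_bounded S -> A_bounded (op_add T S).
Proof.
move=> [k k0 hk] [l l0 hl]; exists (k + l); first exact: addr_ge0.
by move=> x; rewrite mulrDl; exact: le_trans (ipnormD hB _ _) (lerD (hk x) (hl x)).
Qed.

Lemma A_bounded_sub T S : A_bounded T -> A_bounded S -> A_bounded (op_sub T S).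
Proof.
move=> bT [k k0 hk]; apply: (A_bounded_add (S := fun x => - S x)); first exact: bT.
by exists k => // x; rewrite (ipnormN hB (S x) : NA _ = NA _) hk.
Qed.

(** [NA (S y) ^+ 2 = B (T (S y)) y <= k * NA (S y) * NA y], and one factor [NA (S y)] cancels. *)
Lemma A_bounded_adjoint T S :
  (forall x y, B (T x) y = B x (S y)) -> A_bounded T -> A_bounded S.
Proof.
move=> adj [k k0 hk]; exists k => // y.
have [->|n0] := eqVneq (NA (S y)) 0; first by rewrite mulr_ge0 // normA_ge0.
have np : 0 < NA (S y) by rewrite lt_def n0 normA_ge0.
rewrite -(ler_pM2r np) -expr2 [NA _ ^+ 2](sqr_ipnorm hB) -adj.
rewrite (le_trans (Re_le_normc _)) // (le_trans (cauchy_schwarz hB _ _)) //.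
by rewrite mulrAC ler_wpM2r ?normA_ge0 //; exact: hk.
Qed.

(* [P = S T] is symmetric for [B], so [n |-> NA (P ^ n x)] is log-convex; as it is
   [O(K ^ n)] with [K] a bound for [P] in the Hilbert norm, [NA (P x) <= K * NA x]. *)
Lemma in_BA_A_bounded T : in_BA ip A T -> A_bounded T.
Proof.
move=> [bT [S [bS adj]]].
have [bA _] := pA.
have [c c0 hc] := bounded_op_gt0 bA.
have [k k0 hk] := bounded_op_gt0 bT.
have [l l0 hl] := bounded_op_gt0 bS.
pose P := op_comp S T; pose K := l * k.
have K0 : 0 < K by rewrite mulr_gt0.
have hP x : N (P x) <= K * N x.
  by rewrite (le_trans (hl _)) // -mulrA ler_wpM2l // ltW.
have symP x y : B (P x) y = B x (P y).
  by rewrite (form_conj hB) -adj -(form_conj hB) adj.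
have NAle x : NA x <= Num.sqrt c * N x.
  rewrite -ler_sqr ?qualifE /= ?mulr_ge0 ?sqrtr_ge0 // exprMn.
  rewrite [Num.sqrt c ^+ 2]sqr_sqrtr ?(ltW c0) //
    [NA _ ^+ 2](sqr_ipnorm hB) (le_trans (Re_le_normc _)) //.
  rewrite (le_trans (cauchy_schwarz hI _ _)) // expr2 mulrA ler_wpM2r //.
  exact: ipnorm_ge0.
have PK x : NA (P x) <= K * NA x.
  (* The constant [Num.sqrt c * N x] depends on [x], which is harmless: the resulting ratio bound
     [K] does not. *)
  apply: (@log_convex_ratio _ (fun n => NA (iter n P x)) (Num.sqrt c * N x)) => // n /=.
  - exact: normA_ge0.
  - rewrite [NA _ ^+ 2](sqr_ipnorm hB) symP.
    exact: le_trans (Re_le_normc _) (cauchy_schwarz hB _ _).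
  - rewrite (le_trans (NAle _)) // -mulrA ler_wpM2l ?sqrtr_ge0 //.
    elim: n => [|n IH]; first by rewrite mulr1.
    by rewrite (le_trans (hP _)) // exprS mulrCA ler_wpM2l // ltW.
(* [NA (T x) ^+ 2 = B x (P x) <= NA x * (K * NA x)]. *)
exists (Num.sqrt K) => [|x]; first exact: sqrtr_ge0.
rewrite -ler_sqr ?qualifE /= ?mulr_ge0 ?sqrtr_ge0 // exprMn.
rewrite [Num.sqrt K ^+ 2]sqr_sqrtr ?(ltW K0) //
  [NA (T x) ^+ 2](sqr_ipnorm hB) adj (le_trans (Re_le_normc _)) //.
rewrite (le_trans (cauchy_schwarz hB _ _)) // mulrC expr2 mulrA ler_wpM2r ?ipnorm_ge0 //.
exact: PK.
Qed.

(** The Hilbert adjoint of [T] at [A y] is [A (S y)], so [sharpA] and [S] differ at [y] by an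
    element of the kernel of [A], which the form does not see. *)
Lemma sharpA_adjoint T x y : in_BA ip A T -> B (T x) y = B x (sharpA ip A T y).
Proof.
move=> [bT [S [bS adj]]]; have [bA _] := pA.
have Tadj u : ip (T u) (A y) = ip u (A (S y)).
  have symA v w : ip v (A w) = B v w by rewrite (form_conj hI (A w) v) (form_conj hB w v).
  by rewrite !symA.
have E : adjoint ip T (A y) = A (S y).
  have h : [set z | forall u, ip (T u) (A y) = ip u z]%classic (adjoint ip T (A y)).
    by apply: xgetPex; exists (A (S y)).
  (* Two vectors representing the same functional coincide: their difference [d] satisfies
     [ip d d = 0]. *)
  apply/eqP; rewrite -subr_eq0; apply/eqP/ipnorm_eq0.
  set d := _ - _; have : ip d d = 0.
    by rewrite {2}/d (formDr hI) (formNr hI) -(h d) Tadj subrr.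
  by rewrite (form_self hI) => /(congr1 (@complex.Re R)) /= /eqP; rewrite sqrf_eq0 => /eqP ->.
rewrite adj /sharpA E (form_conj hB) [RHS](form_conj hB).
by rewrite /ipA mp_invK.
Qed.

Lemma opnormA_ub T x : A_bounded T -> NA x = 1 -> NA (T x) <= opnormA ip A T.
Proof.
move=> [k k0 hk] x1; apply: ub_le_sup; last by exists x.
by exists k => _ [y y1 <-]; rewrite (le_trans (hk _)) // (y1 : NA y = 1) mulr1.
Qed.

Lemma form_le_opnormA T x : A_bounded T -> NA x = 1 ->
  normc (B (T x) x) <= opnormA ip A T.
Proof.
move=> bT x1; rewrite (le_trans (cauchy_schwarz hB _ _)) //.
by rewrite [ipnorm B x]x1 mulr1; exact: opnormA_ub.
Qed.

Lemma omegaA_ub T x : A_bounded T -> NA x = 1 ->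
  normc (B (T x) x) <= omegaA ip A T.
Proof.
move=> [k k0 hk] x1; apply: ub_le_sup; last by exists x.
exists k => _ [y /= y1 <-]; rewrite (le_trans (cauchy_schwarz hB _ _)) //.
by rewrite [ipnorm B y]y1 mulr1 (le_trans (hk _)) // y1 mulr1.
Qed.

End Hilbert.

(** * The numerical radius bound for a sum *)

Theorem theorem3p2 (R : realType) (H : lmodType R[i]) (ip : H -> H -> R[i])
  (A T S : H -> H) :
  is_hilbert ip ->
  is_positive_op ip A -> (exists x, A x != 0) ->
  in_BA ip A T -> in_BA ip A S ->
  omegaA ip A (op_add T S) <=
  Num.sqrt (2^-1 * (opnormA ip A (op_add (op_comp T (sharpA ip A T)) (op_comp S (sharpA ip A S)))
                  + opnormA ip A (op_sub (op_comp T (sharpA ip A T)) (op_comp S (sharpA ip A S))))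
            + omegaA ip A (op_comp S (sharpA ip A T))
            + 2 * omegaA ip A T * omegaA ip A S).
Proof.
move=> hH pA _ TBA SBA; have hB := positive_semi_inner hH pA.
pose T' := sharpA ip A T; pose S' := sharpA ip A S.
have adjT x y : ipA ip A (T x) y = ipA ip A x (T' y) by exact: sharpA_adjoint.
have adjS x y : ipA ip A (S x) y = ipA ip A x (S' y) by exact: sharpA_adjoint.
have bT : A_bounded ip A T by exact: in_BA_A_bounded.
have bS : A_bounded ip A S by exact: in_BA_A_bounded.
have bT' : A_bounded ip A T' by exact: (A_bounded_adjoint hH pA adjT).
have bS' : A_bounded ip A S' by exact: (A_bounded_adjoint hH pA adjS).
rewrite {1}/omegaA; set E := (X in sup X <= _).
(* [ge_sup] needs a nonempty set; the supremum of the empty set is [0] by convention. *)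
have [E0|/set0P En0] := eqVneq E set0.
  by rewrite E0 sup0 sqrtr_ge0.
apply: ge_sup => // _ [x /= x1 <-].
pose p := normc (ipA ip A (T x) x); pose q := normc (ipA ip A (S x) x).
have p0 : 0 <= p by exact: normc_nonneg.
have q0 : 0 <= q by exact: normc_nonneg.
apply: (@le_trans _ _ (p + q)).
  by rewrite [ipA _ _ _ _](formDl hB); exact: normc_leD.
have pT : p <= omegaA ip A T by exact: omegaA_ub.
have qS : q <= omegaA ip A S by exact: omegaA_ub.
have dST : normc (ipA ip A (T' x) (S' x)) <= omegaA ip A (op_comp S T').
  by rewrite -adjS; apply: (omegaA_ub hH pA) => //; exact: A_bounded_comp.
set a := ipnorm (ipA ip A) (T' x) ^+ 2; set b := ipnorm (ipA ip A) (S' x) ^+ 2.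
have Ta : ipA ip A (T (T' x)) x = (a%:C)%C by rewrite adjT (form_self hB).
have Sb : ipA ip A (S (S' x)) x = (b%:C)%C by rewrite adjS (form_self hB).
have bTT' := A_bounded_comp bT bT'; have bSS' := A_bounded_comp bS bS'.
have hp := form_le_opnormA hH pA (A_bounded_add hH pA bTT' bSS') x1.
have hm := form_le_opnormA hH pA (A_bounded_sub hH pA bTT' bSS') x1.
have Ep : ipA ip A (op_add (op_comp T T') (op_comp S S') x) x = ((a + b)%:C)%C.
  by rewrite [LHS](formDl hB) Ta Sb -rmorphD.
have Em : ipA ip A (op_sub (op_comp T T') (op_comp S S') x) x = ((a - b)%:C)%C.
  by rewrite [LHS](formDl hB) (formNl hB) Ta Sb -rmorphB.
rewrite Ep in hp; rewrite Em in hm.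
have hab := le_trans (Re_le_normc _) hp.
have hamb := le_trans (Re_le_normc _) hm.
(* Both signs of [a - b] are needed: [max(a, b)] is half of [(a + b) + |a - b|], which gives the
   common bound [M] for Boas-Bellman. *)
have hbma : b - a <= opnormA ip A (op_sub (op_comp T T') (op_comp S S')).
  apply: le_trans hm; rewrite -opprB -[normc _]normcN.
  exact: (Re_le_normc (- ((a - b)%:C)%C)).
move: hab hamb hbma; rewrite /= {hp hm}.
set np := opnormA _ _ _; set nm := opnormA _ _ _ => hab hamb hbma.
have aM : a <= 2^-1 * (np + nm) by lra.
have bM : b <= 2^-1 * (np + nm) by lra.
have := boas_bellman2 hB x aM bM.
rewrite [ipnorm _ x]x1 expr1n mul1r -adjT -adjS -/p -/q => pq.
have pqST : p * q <= omegaA ip A T * omegaA ip A S by rewrite ler_pM.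
(* With [p + q] written as the root of its square, [(p + q)^2 = p^2 + q^2 + 2pq] is compared under
   the root: [pq] bounds the squares and [pqST] the product. *)
rewrite -[leLHS]ger0_norm ?addr_ge0 // -sqrtr_sqr ler_wsqrtr //.
move: pq pqST dST; rewrite -/np -/nm.
set d := normc _; set w := omegaA _ _ (op_comp _ _) => pq pqST dST.
rewrite -mulrA; lra.
Qed.
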